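(* Let $X\hookrightarrow L^2(D)$ be a separable Banach space (continuous embedding), $\mu$ a Borel probability measure on $X$ with $\int_X\|u\|_X^2\,d\mu(u)<\infty$ such that $\mu(A)=1$ for some Borel set $A\subset X$ of continuous functions, and let $\mathcal{G}:X\to L^2(U)$ be a Borel measurable operator with $\int_X\|\mathcal{G}(u)\|_{L^2(U)}^2\,d\mu(u)<\infty$. Let $\mathcal{N}=\mathcal{R}\circ\mathcal{A}\circ\mathcal{E}$ be an arbitrary DeepONet approximation of $\mathcal{G}$, with encoder $\mathcal{E}:C(D)\to\mathbb{R}^m$, approximator $\mathcal{A}:\mathbb{R}^m\to\mathbb{R}^p$ and reconstructor $\mathcal{R}:\mathbb{R}^p\to L^2(U)$, $\mathcal{R}(\alpha)=\tau_0+\sum_{k=1}^p\alpha_k\tau_k$ with $\tau_1,\dots,\tau_p$ linearly independent in $L^2(U)$. Let $\mathcal{P}:L^2(U)\to\mathbb{R}^p$ be the optimal affine projection associated with $\mathcal{R}$. Then $$\sqrt{\sum_{k>p}\lambda_k}\;\le\;\widehat{\mathscr{E}}_{\mathcal{R}}\;\le\;\widehat{\mathscr{E}},$$ where $\lambda_1\ge\lambda_2\ge\dots$ are the eigenvalues (repeated according to multiplicity) of the covariance operator $\Gamma_{\mathcal{G}_\#\mu}$ of the push-forward measure $\mathcal{G}_\#\mu$.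
   Context: $D\subset\mathbb{R}^d$, $U\subset\mathbb{R}^n$ are compact domains. DeepONet: $\mathcal{N}=\mathcal{R}\circ\mathcal{A}\circ\mathcal{E}$ with $\mathcal{E}(u)=(u(x_1),\dots,u(x_m))$ for sensor points $x_j\in D$, $\mathcal{A}$ a ReLU neural network, and $\tau=(\tau_0,\dots,\tau_p):\mathbb{R}^n\to\mathbb{R}^{p+1}$ a ReLU neural network (trunk net). Optimal affine projection associated with $\mathcal{R}$: $\mathcal{P}(v)=(\langle v-\tau_0,\tau_1^*\rangle,\dots,\langle v-\tau_0,\tau_p^*\rangle)$, where $\tau_1^*,\dots,\tau_p^*\in\mathrm{span}(\tau_1,\dots,\tau_p)$ is the dual basis, $\langle\tau_\ell,\tau_k^*\rangle=\delta_{\ell k}$ in $L^2(U)$; equivalently $\mathcal{R}\circ\mathcal{P}$ is the orthogonal projection of $L^2(U)$ onto the affine subspace $\mathrm{Im}(\mathcal{R})$. Errors: $\widehat{\mathscr{E}}=\left(\int_X\|\mathcal{G}(u)-\mathcal{N}(u)\|_{L^2(U)}^2\,d\mu(u)\right)^{1/2}$ and $\widehat{\mathscr{E}}_{\mathcal{R}}=\left(\int_{L^2(U)}\|\mathcal{R}\circ\mathcal{P}(v)-v\|_{L^2(U)}^2\,d(\mathcal{G}_\#\mu)(v)\right)^{1/2}$. Covariance operator: $\Gamma_{\nu}=\int (v-\mathbb{E}_\nu[v])\otimes(v-\mathbb{E}_\nu[v])\,d\nu(v)$ on $L^2(U)$, with $\mathbb{E}_\nu[v]=\int v\,d\nu(v)$.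 *)

(* Defs.v *)
From HB Require Import structures.
From mathcomp Require Import all_boot all_order all_algebra.
From mathcomp Require Import all_classical all_reals all_analysis.
From mathcomp Require Import measurable_realfun ess_sup_inf.

Set Implicit Arguments.
Unset Strict Implicit.
Unset Printing Implicit Defensive.

Import Order.TTheory GRing.Theory Num.Theory.
Import numFieldNormedType.Exports.

Local Open Scope classical_set_scope.
Local Open Scope ring_scope.

Section power_measure.
Context d (T : measurableType d) (R : realType).

Definition tuple_cons n (x : T * n.-tuple T) : n.+1.-tuple T :=
  [tuple of x.1 :: x.2].

Definition tuple_uncons n (x : n.+1.-tuple T) : T * n.-tuple T :=
  (thead x, [tuple of behead x]).

Lemma tuple_consK n : cancel (@tuple_cons n) (@tuple_uncons n).
Proof. by move=> [a b]; congr (_, _); exact: val_inj. Qed.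

Lemma measurable_tuple_cons n : measurable_fun setT (@tuple_cons n).
Proof. exact: measurable_cons. Qed.

Lemma measurable_tuple_uncons n : measurable_fun setT (@tuple_uncons n).
Proof.
apply: measurable_fun_pair; first exact: measurable_tnth.
exact: measurable_behead.
Qed.

Section cons_measure.
Variables (m : {sigma_finite_measure set T -> \bar R}) (n : nat).
Variables (mu : {sigma_finite_measure set (n.-tuple T) -> \bar R}).
Local Open Scope ereal_scope.

Definition cons_measure : set (n.+1.-tuple T) -> \bar R :=
  pushforward (m \x mu) (@tuple_cons n).

Let cons_measure0 : cons_measure set0 = 0.
Proof. by rewrite /cons_measure /pushforward preimage_set0 measure0. Qed.

Let cons_measure_ge0 A : 0 <= cons_measure A.
Proof. exact: integral_ge0. Qed.

Let cons_measure_sigma_additive : semi_sigma_additive cons_measure.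
Proof.
have mf := @measurable_tuple_cons n.
move=> F mF tF mUF; rewrite /cons_measure /pushforward preimage_bigcup.
apply: measure_semi_sigma_additive.
- by move=> k; rewrite -[X in measurable X]setTI; exact: mf.
- apply/trivIsetP => /= i j _ _ ij; rewrite -preimage_setI.
  by move/trivIsetP : tF => /(_ _ _ _ _ ij) ->//; rewrite preimage_set0.
- by rewrite -preimage_bigcup -[X in measurable X]setTI; exact: mf.
Qed.

HB.instance Definition _ := isMeasure.Build _ _ _ cons_measure
  cons_measure0 cons_measure_ge0 cons_measure_sigma_additive.

Let cons_measure_sigma_finite : sigma_finite setT cons_measure.
Proof.
have /sigma_finiteP[F [TF ndF Foo]] := sigma_finiteT m.
have /sigma_finiteP[G [TG ndG Goo]] := sigma_finiteT mu.
exists (fun k => @tuple_uncons n @^-1` (F k `*` G k)).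
  rewrite -preimage_bigcup [X in _ @^-1` X](_ : _ = setT) ?preimage_setT//.
  rewrite -setXTT TF TG predeqE => -[x y]; split.
    by move=> [k _ []/= ? ?]; split; exists k.
  move=> [/= [i _ Fix] [k _ Gky]]; exists (maxn i k) => //; split.
  - by move: x Fix; exact/subsetPset/ndF/leq_maxl.
  - by move: y Gky; exact/subsetPset/ndG/leq_maxr.
move=> k; have [mF Fk] := Foo k; have [mG Gk] := Goo k; split.
  rewrite -[X in measurable X]setTI; apply: measurable_tuple_uncons => //.
  exact: measurableX.
rewrite /cons_measure /pushforward -comp_preimage.
rewrite (_ : _ \o _ = id); last by apply/funext; exact: tuple_consK.
by rewrite preimage_id product_measure1E// lte_mul_pinfty// ge0_fin_numE.
Qed.

HB.instance Definition _ := Measure_isSigmaFinite.Build _ _ _ cons_measure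
  cons_measure_sigma_finite.

End cons_measure.

Fixpoint power_measure (m : {sigma_finite_measure set T -> \bar R}) n :
    {sigma_finite_measure set (n.-tuple T) -> \bar R} :=
  if n is n'.+1 then cons_measure m (power_measure m n')
  else @dirac _ _ [tuple] R.

End power_measure.

(* T as a measurable type for its Borel sigma-algebra *)
Notation borel T := (g_sigma_algebraType (@open T)).

Section lebesgue_measure_rV.
Variables (R : realType) (n : nat).

Definition row_of_tuple (x : n.-tuple (measurableTypeR R)) : borel 'rV[R]_n :=
  \row_i tnth x i.

Lemma measurable_row_of_tuple : measurable_fun setT row_of_tuple.
Proof.
move=> _; apply: (@smallest_sub _ (sigma_algebra setT) _
  [set A : set 'rV[R]_n | measurable (setT `&` row_of_tuple @^-1` A)]).
  split=> [/=|A /=|F /= mF].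
  - by rewrite preimage_set0 setI0.
  - rewrite !setTI setTD preimage_setC => mA; exact: measurableC.
  - by rewrite setTI preimage_bigcup; apply: bigcupT_measurable => k;
      rewrite -[X in measurable X]setTI; exact: mF.
move=> O oO; rewrite /= setTI.
pose I := ('rV[rat]_n * nat)%type.
pose c (k : I) : 'rV[R]_n := map_mx ratr k.1.
pose e (k : I) : R := k.2.+1%:R^-1.
pose B (k : I) :=
  if `[< ball (c k) (e k) `<=` O >] then ball (c k) (e k) else set0.
have -> : O = \bigcup_k B k.
  apply/seteqP; split=> [x Ox|x [k _]]; last first.
    by rewrite /B; case: ifPn => // /asboolP; exact.
  have := open_nbhs_nbhs (conj oO Ox); rewrite -nbhs_ballE => -[r /= r0 xrO].
  have [k rk] : exists k : nat, k.+1%:R^-1 < r / 2.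
    have [k _ rk] := near_infty_natSinv_lt (PosNum (divr_gt0 r0 (ltr0n R 2))).
    by exists k; exact: (rk k (leqnn k)).
  have /choice[q qP] : forall j, exists q : rat, `|x ord0 j - ratr q| < k.+1%:R^-1.
    move=> j; have : x ord0 j - k.+1%:R^-1 < x ord0 j + k.+1%:R^-1.
      by rewrite ltrD2l (@lt_trans _ _ 0)// ?oppr_lt0 invr_gt0 ltr0n.
    move=> /rat_in_itvoo[q]; rewrite in_itv/= => /andP[q1 q2]; exists q.
    by rewrite ltr_distlC q1.
  have cE : c (\row_j q j, k) = \row_j ratr (q j) by apply/rowP => j; rewrite !mxE.
  exists (\row_j q j, k) => //; rewrite /B cE ifT.
    split => [|i j]; first by rewrite invr_gt0.
    by rewrite (ord1 i) !mxE /ball/= distrC.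
  apply/asboolP => y [_ qy]; apply: xrO; split => // i j.
  have := qy i j; rewrite (ord1 i) mxE /ball/= => qyj.
  rewrite -[x ord0 j](subrK (ratr (q j))) -addrA (splitr r).
  rewrite (le_lt_trans (ler_normD _ _))// ltrD//; first exact: (lt_trans (qP j)).
  exact: (lt_trans qyj).
rewrite preimage_bigcup; apply: countable_bigcupT_measurable => [|k].
  exact: countableP.
rewrite /B; case: ifPn => _; last by rewrite preimage_set0.
have -> : row_of_tuple @^-1` ball (c k) (e k) =
   \bigcap_(j in [set: 'I_n])
     (fun x : n.-tuple (measurableTypeR R) => tnth x j) @^-1`
       ball (c k ord0 j) (e k).
  apply/seteqP; split=> [x [_ xB] j _|x xB] /=.
    by have := xB ord0 j; rewrite /row_of_tuple [X in ball _ _ X]mxE.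
  split=> [|i j]; first by rewrite invr_gt0.
  by rewrite (ord1 i) /row_of_tuple [X in ball _ _ X]mxE; exact: xB.
apply: fin_bigcap_measurable => // j _.
rewrite -[X in measurable X]setTI.
by apply: measurable_tnth => //; rewrite ball_itv; exact: measurable_itv.
Qed.

Definition lebesgue_rV : set (borel 'rV[R]_n) -> \bar R :=
  pushforward (power_measure (@lebesgue_measure R) n) row_of_tuple.

HB.instance Definition _ := Measure.copy lebesgue_rV
  (measure_function_pushforward__canonical__measure_function_Measure
     (power_measure (@lebesgue_measure R) n) measurable_row_of_tuple).

End lebesgue_measure_rV.

Section compact_domain.
Variables (R : realType) (n : nat).

(* Compact sets which are the closure of an open set, not necessarily connected.
   On such a set a class of L2 has at most one continuous version, so that its
   value at a point of the set makes sense. *)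
Record compact_domain := CompactDomain {
  domain_set :> set 'rV[R]_n;
  domain_compact : compact domain_set;
  domain_regular : closure (interior domain_set) = domain_set }.

Lemma measurable_domain (D : compact_domain) :
  measurable (domain_set D : set (borel 'rV[R]_n)).
Proof.
have cD : closed (domain_set D).
  by apply: compact_closed; [exact: norm_hausdorff|exact: domain_compact].
rewrite -[domain_set D]setCK; apply: measurableC; apply: sub_sigma_algebra.
exact: closed_openC.
Qed.

(* Lebesgue measure restricted to D: L2 of this measure on R^n is L2(D) *)
Definition domain_measure (D : compact_domain) :
    {measure set (borel 'rV[R]_n) -> \bar R} :=
  mrestr (@lebesgue_rV R n) (measurable_domain D).

End compact_domain.

Lemma ae_eq_Lnorm d (T : measurableType d) (R : realType)
    (mu : {measure set T -> \bar R}) (p : \bar R) (f g : T -> R) :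
    measurable_fun setT f -> measurable_fun setT g -> f = g %[ae mu] ->
  ('N[mu]_p[EFin \o f] = 'N[mu]_p[EFin \o g])%E.
Proof.
move=> mf mg fg.
have mpow (h : T -> R) r : measurable_fun [set: T] h ->
    measurable_fun [set: T] (fun x => `|(EFin \o h) x| `^ r)%E.
  move=> mh; apply: (@measurableT_comp _ _ _ _ _ _ (fun x => x `^ r)%E) => //=.
    exact: measurable_poweR.
  by do 2 apply: measurableT_comp => //.
rewrite unlock; case: p => [r||].
- congr (_ `^ _)%E; apply: ge0_ae_eq_integral => //;
    [exact: mpow|exact: mpow|by move=> *; exact: poweR_ge0|
     by move=> *; exact: poweR_ge0|].
  by apply: filterS fg => x /= /[apply] ->.
- case: ifPn => // _; apply: eq_ess_sup.
  by apply: filterS fg => x /= /(_ I) ->.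
- case: ifPn => // _; apply: eq_ess_inf.
  by apply: filterS fg => x /= /(_ I) ->.
Qed.

Section Lspace_of_Lfun.
Context d (T : measurableType d) (R : realType).
Variables (mu : {measure set T -> \bar R}) (p : \bar R) (p1 : (1 <= p)%E).
Local Notation Lp := (LspaceType mu p1).
Local Notation Lf := (LfunType mu p1).
Local Open Scope quotient_scope.

Local Notation Mq := {mfun_ mu, T >-> measurableTypeR R}.

Lemma Lfun_of_subproof (u : Lp) : (u : T -> R) \in Lfun mu p.
Proof.
rewrite inE; apply/andP; split; rewrite inE/=; last exact: Lebesgue_finite.
exact: (@measurable_funPT _ _ _ _ (repr (u : Mq))).
Qed.

Definition Lfun_of (u : Lp) : Lf := Lfun_Sub p1 (Lfun_of_subproof u).

Lemma ae_eq_repr (f : {mfun T >-> measurableTypeR R}) :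
  repr (\pi_Mq f) = f %[ae mu].
Proof.
by have /eqmodP/asboolP := reprK (\pi_Mq f).
Qed.

Definition mfun_of (f : Lf) : {mfun T >-> measurableTypeR R} :=
  MeasurableFun.Pack (MeasurableFun.Class
    (isMeasurableFun.Build _ _ T (measurableTypeR R) f
       (@measurable_funPT _ _ _ _ f))).

Lemma Lspace_of_subproof (f : Lf) :
  finite_norm mu p (\pi_Mq (mfun_of f) : Mq).
Proof.
rewrite /finite_norm (@ae_eq_Lnorm _ _ _ mu p _ f)//.
- exact: Lfunction_finite.
- exact: (@measurable_funPT _ _ _ _ (repr (\pi_Mq (mfun_of f)))).
- exact: ae_eq_repr.
Qed.

Definition Lspace_of (f : Lf) : Lp :=
  LebesgueSpace.Pack (LebesgueSpace.Class
    (isFinLebesgue.Build _ _ _ _ _ p1 (\pi_Mq (mfun_of f) : Mq)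
       (Lspace_of_subproof f))).

Lemma Lspace_of_ae (f : Lf) : (Lspace_of f : T -> R) = f %[ae mu].
Proof. exact: ae_eq_repr. Qed.

Lemma Lspace_val_inj (u v : Lp) : (u : Mq) = (v : Mq) -> u = v.
Proof.
case: u v => [u [[uP]]] [v [[vP]]] /= uv; rewrite uv in uP *.
by congr LebesgueSpace.Pack; congr LebesgueSpace.Class; congr isFinLebesgue.Axioms_;
  exact: Prop_irrelevance.
Qed.

Lemma Lspace_eqP (u v : Lp) : u = v <-> (u : T -> R) = v %[ae mu].
Proof.
split=> [->|uv]; first exact: ae_eq_refl.
apply: Lspace_val_inj; rewrite -[u : Mq]reprK -[v : Mq]reprK.
exact/eqmodP/asboolP.
Qed.

Lemma Lfun_ofK : cancel Lfun_of Lspace_of.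
Proof. by move=> u; apply/Lspace_eqP; exact: Lspace_of_ae. Qed.

Lemma Lspace_of_eqP (f g : Lf) : Lspace_of f = Lspace_of g <-> f = g %[ae mu].
Proof.
split=> [/Lspace_eqP fg|fg].
  have fe := Lspace_of_ae f; have ge := Lspace_of_ae g.
  by apply: filterS3 fg fe ge => x /= + + + _ => /(_ I) + /(_ I) <- /(_ I) <-.
apply/Lspace_eqP; have fe := Lspace_of_ae f; have ge := Lspace_of_ae g.
by apply: filterS3 fg fe ge => x /= + + + _ => /(_ I) + /(_ I) -> /(_ I) ->.
Qed.

End Lspace_of_Lfun.

(* The library provides LspaceType (measurable functions of finite p-norm
   modulo a.e. equality) as a bare type; its vector space structure and norm
   are transported from LfunType through representatives. *)
Section Lspace_normedModType.
Context d (T : measurableType d) (R : realType).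
Variables (mu : {measure set T -> \bar R}) (p : \bar R) (p1 : (1 <= p)%E).
Local Notation Lp := (LspaceType mu p1).
Local Notation cl := (@Lspace_of d T R mu p p1).
Local Notation rp := (@Lfun_of d T R mu p p1).
Implicit Types (f g : LfunType mu p1) (u v w : Lp).

HB.instance Definition _ := gen_eqMixin Lp.
HB.instance Definition _ := gen_choiceMixin Lp.

Definition Lspace0 : Lp := cl 0.
Definition Lspace_opp u : Lp := cl (- rp u).
Definition Lspace_add u v : Lp := cl (rp u + rp v).
Definition Lspace_scale (a : R) u : Lp := cl (a *: rp u).

Lemma Lspace_addE f g : Lspace_add (cl f) (cl g) = cl (f + g).
Proof.
apply/Lspace_of_eqP.
by apply: filterS2 (Lspace_of_ae f) (Lspace_of_ae g) => x /= fx gx I;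
  congr (_ + _); [exact: fx|exact: gx].
Qed.

Lemma Lspace_oppE f : Lspace_opp (cl f) = cl (- f).
Proof.
apply/Lspace_of_eqP.
by apply: filterS (Lspace_of_ae f) => x /= fx I; congr (- _); exact: fx.
Qed.

Lemma Lspace_scaleE a f : Lspace_scale a (cl f) = cl (a *: f).
Proof.
apply/Lspace_of_eqP.
by apply: filterS (Lspace_of_ae f) => x /= fx I; congr (_ *: _); exact: fx.
Qed.

Let addA : associative Lspace_add.
Proof.
move=> u v w; rewrite -(Lfun_ofK u) -(Lfun_ofK v) -(Lfun_ofK w).
by rewrite !Lspace_addE addrA.
Qed.

Let addC : commutative Lspace_add.
Proof. by move=> u v; rewrite /Lspace_add addrC. Qed.

Let add0 : left_id Lspace0 Lspace_add.
Proof. by move=> u; rewrite -(Lfun_ofK u) Lspace_addE add0r. Qed.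

Let addN : left_inverse Lspace0 Lspace_opp Lspace_add.
Proof. by move=> u; rewrite -(Lfun_ofK u) Lspace_oppE Lspace_addE addNr. Qed.

HB.instance Definition _ := GRing.isZmodule.Build Lp addA addC add0 addN.

Let scaleA a b u : Lspace_scale a (Lspace_scale b u) = Lspace_scale (a * b) u.
Proof. by rewrite -(Lfun_ofK u) !Lspace_scaleE scalerA. Qed.

Let scale1 : left_id 1 Lspace_scale.
Proof. by move=> u; rewrite -(Lfun_ofK u) Lspace_scaleE scale1r. Qed.

Let scaleDr : right_distributive Lspace_scale +%R.
Proof.
move=> a u v; rewrite -(Lfun_ofK u) -(Lfun_ofK v); set f := rp u; set g := rp v.
change (Lspace_scale a (Lspace_add (cl f) (cl g)) =
  Lspace_add (Lspace_scale a (cl f)) (Lspace_scale a (cl g))).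
by rewrite (Lspace_addE f g) !Lspace_scaleE Lspace_addE scalerDr.
Qed.

Let scaleDl u : {morph Lspace_scale^~ u : a b / a + b}.
Proof.
move=> a b; rewrite -(Lfun_ofK u); set f := rp u.
change (Lspace_scale (a + b) (cl f) =
  Lspace_add (Lspace_scale a (cl f)) (Lspace_scale b (cl f))).
by rewrite !Lspace_scaleE Lspace_addE scalerDl.
Qed.

HB.instance Definition _ :=
  GRing.Zmodule_isLmodule.Build R Lp scaleA scale1 scaleDr scaleDl.

Definition Lspace_norm u : R := fine ('N[mu]_p[EFin \o (u : T -> R)])%E.

Lemma Lspace_normE f : Lspace_norm (cl f) = fine ('N[mu]_p[EFin \o f])%E.
Proof.
congr fine; apply: ae_eq_Lnorm => //; last exact: Lspace_of_ae.
exact: (measurable_funPT (Lfun_of (cl f))).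
Qed.

Lemma Lspace_ofD f g : cl f + cl g = cl (f + g).
Proof. exact: Lspace_addE. Qed.

Lemma Lspace_ofN f : - cl f = cl (- f).
Proof. exact: Lspace_oppE. Qed.

Lemma Lspace_ofZ a f : a *: cl f = cl (a *: f).
Proof. exact: Lspace_scaleE. Qed.

Let norm_leD u v : Lspace_norm (u + v) <= Lspace_norm u + Lspace_norm v.
Proof.
rewrite -(Lfun_ofK u) -(Lfun_ofK v) Lspace_ofD !Lspace_normE.
exact: ler_LnormD.
Qed.

Let norm_Z a u : Lspace_norm (a *: u) = `|a| * Lspace_norm u.
Proof.
rewrite -(Lfun_ofK u) Lspace_ofZ !Lspace_normE; set f := rp u.
apply: EFin_inj; rewrite EFinM !finite_norm_fine; exact: LnormZ.
Qed.

Let norm_eq0 u : Lspace_norm u = 0 -> u = 0.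
Proof.
rewrite -(Lfun_ofK u) Lspace_normE => /fine_Lnormr_eq0 u0.
exact/Lspace_of_eqP.
Qed.

HB.instance Definition _ :=
  Lmodule_isNormed.Build R Lp norm_leD norm_Z norm_eq0.

End Lspace_normedModType.

Section L2_inner_product.
Context d (T : measurableType d) (R : realType) (mu : {measure set T -> \bar R}).
Local Notation L2 := (LspaceType mu (lee1n 2)).

Lemma L2_normE (u : L2) : `|u| = fine ('N[mu]_2%:R%:E[EFin \o (u : T -> R)])%E.
Proof. by []. Qed.

Definition L2_dot (u v : L2) : R := (\int[mu]_x (u x * v x))%R.

(* the rank-one operator a (x) b = <b, .> a, applied to w *)
Definition L2_tensor (a b w : L2) : L2 := L2_dot b w *: a.

End L2_inner_product.

Notation L2 D := (LspaceType (domain_measure D) (lee1n 2)).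

Section linear_algebra.
Variables (R : realType) (V : lmodType R).

Definition lin_indep n (e : 'I_n -> V) : Prop :=
  forall c : 'I_n -> R, \sum_i c i *: e i = 0 -> forall i, c i = 0.

Definition lin_span n (e : 'I_n -> V) : set V :=
  [set v | exists c : 'I_n -> R, v = \sum_i c i *: e i].

Definition has_dimension (E : set V) (n : nat) : Prop :=
  exists e : 'I_n -> V, lin_indep e /\ lin_span e = E.

Definition eigenspace (A : V -> V) (a : R) : set V := [set v | A v = a *: v].

(* The eigenvalues of a compact nonnegative self-adjoint operator, in
   nonincreasing order and repeated according to multiplicity, indexed from 0:
   each a > 0 occurs as many times as the dimension of its eigenspace, and the
   sequence is padded with zeros if there are finitely many positive ones. *)
Definition eigenvalue_sequence (A : V -> V) (lambda : nat -> R) : Prop :=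
  [/\ nonincreasing_seq lambda,
      forall k, 0 <= lambda k &
      forall a, 0 < a -> exists n,
        has_dimension (eigenspace A a) n /\ ([set k | lambda k = a] #= `I_n)%card].

End linear_algebra.

Section bochner.
Context d (T : measurableType d) (R : realType) (V : normedModType R).
Variable nu : {finite_measure set T -> \bar R}.

Definition simple_function (s : T -> V) : Prop :=
  finite_set (range s) /\ forall v, measurable (s @^-1` [set v]).

Definition simple_integral (s : T -> V) : V :=
  \sum_(v \in range s) fine (nu (s @^-1` [set v])) *: v.

(* I is the Bochner integral of f: the limit of the integrals of simple
   functions converging to f in L1 *)
Definition is_bochner_integral (f : T -> V) (I : V) : Prop :=
  measurable_fun setT (f : T -> borel V) /\
  exists s : nat -> T -> V,
    [/\ forall k, simple_function (s k),
        (\int[nu]_x `|f x - s k x|%:E @[k --> \oo] --> 0)%E &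
        simple_integral (s k) @[k --> \oo] --> I].

End bochner.

Section covariance.
Context d (T : measurableType d) (R : realType) (mu : {measure set T -> \bar R}).
Local Notation L2 := (LspaceType mu (lee1n 2)).
Variable nu : probability (borel L2) R.

Definition is_mean (m : L2) : Prop := is_bochner_integral nu (fun v : L2 => v) m.

(* C = \int (v - m) (x) (v - m) dnu(v), an integral of operators understood
   strongly, i.e. at each w *)
Definition is_covariance_operator (C : L2 -> L2) : Prop :=
  exists2 m, is_mean m &
    forall w, is_bochner_integral nu (fun v : L2 => L2_tensor (v - m) (v - m) w) (C w).

End covariance.

Section relu_network.
Variable R : realType.

Definition relu (z : R) : R := Num.max 0 z.

Inductive relu_network (m : nat) : forall p, ('rV[R]_m -> 'rV[R]_p) -> Prop :=
| relu_network_affine p (W : 'M[R]_(m, p)) (b : 'rV[R]_p) :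
    relu_network (fun z => z *m W + b)
| relu_network_layer p q (f : 'rV[R]_m -> 'rV[R]_p) (W : 'M[R]_(p, q)) (b : 'rV[R]_q) :
    relu_network f -> relu_network (fun z => map_mx relu (f z) *m W + b).

End relu_network.

Section deeponet.
Variables (R : realType) (d n : nat) (D : compact_domain R d) (U : compact_domain R n).

Definition continuous_versions (u : L2 D) : set ('rV[R]_d -> R) :=
  [set g | {within D, continuous g} /\ (u : 'rV[R]_d -> R) = g %[ae domain_measure D]].

(* extended by 0 to the classes that have no continuous version *)
Definition continuous_version (u : L2 D) : 'rV[R]_d -> R :=
  xget (fun=> 0) (continuous_versions u).

Record deeponet (m p : nat) := DeepONet {
  sensor : 'I_m -> 'rV[R]_d;
  sensor_in : forall j, domain_set D (sensor j);
  approximator : 'rV[R]_m -> 'rV[R]_p;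
  approximator_relu : relu_network approximator;
  trunk : 'rV[R]_n -> 'rV[R]_p.+1;
  trunk_relu : relu_network trunk;
  (* the components tau_0, .., tau_p of the trunk net as elements of L2(U) *)
  trunk_class : 'I_p.+1 -> L2 U;
  trunk_classE : forall k,
    (trunk_class k : 'rV[R]_n -> R) = (fun y => trunk y ord0 k) %[ae domain_measure U];
  trunk_indep : lin_indep (fun k : 'I_p => trunk_class (lift ord0 k)) }.

Variables (m p : nat) (N : deeponet m p).

Definition trunk0 : L2 U := trunk_class N ord0.

Definition trunk_basis (k : 'I_p) : L2 U := trunk_class N (lift ord0 k).

Definition encoder (g : 'rV[R]_d -> R) : 'rV[R]_m := \row_j g (sensor N j).

Definition reconstructor (a : 'rV[R]_p) : L2 U :=
  trunk0 + \sum_k a ord0 k *: trunk_basis k.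

Definition deeponet_eval (u : L2 D) : L2 U :=
  reconstructor (approximator N (encoder (continuous_version u))).

Definition is_dual_basis (taus : 'I_p -> L2 U) : Prop :=
  (forall k, lin_span trunk_basis (taus k)) /\
  (forall l k, L2_dot (trunk_basis l) (taus k) = (l == k)%:R).

(* the dual basis exists and is unique as the trunk basis is independent *)
Definition is_optimal_projection (P : L2 U -> 'rV[R]_p) : Prop :=
  exists2 taus, is_dual_basis taus &
    forall v, P v = \row_k L2_dot (v - trunk0) (taus k).

Definition reconstruction_error (nu : probability (borel (L2 U)) R)
    (P : L2 U -> 'rV[R]_p) : \bar R :=
  sqrte (\int[nu]_v (`|reconstructor (P v) - v| ^+ 2)%:E)%E.

Definition deeponet_error (X : normedModType R) (mu : probability (borel X) R)
    (iota : X -> L2 D) (G : X -> L2 U) : \bar R :=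
  sqrte (\int[mu]_u (`|G u - deeponet_eval (iota u)| ^+ 2)%:E)%E.

End deeponet.

(* Main.v *)
(* The residual of the optimal affine projection is orthogonal to the trunk basis,
   so it is pointwise no longer than [v - R(a)] for any [a]; this gives the upper
   bound without any measurability of the network. For the lower bound, let m be
   the mean and e_0, .., e_{N-1} orthonormal eigenvectors of the covariance with
   positive eigenvalues. The span of the e_k contains N - p orthonormal vectors g_j
   orthogonal to the trunk basis. By Bessel's inequality the squared residual is at
   least \sum_j <v - tau_0, g_j>^2, whose integral is at least
   \sum_j <Gamma g_j, g_j>, and Ky Fan's principle bounds this trace from below by
   the sum of the N - p smallest of the N eigenvalues. *)

Require Import Defs.
From HB Require Import structures.
From mathcomp Require Import all_boot all_order all_algebra finmap.
From mathcomp Require Import all_classical all_reals all_analysis.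
From mathcomp Require Import measurable_realfun.

Set Implicit Arguments.
Unset Strict Implicit.
Unset Printing Implicit Defensive.

Import Order.TTheory GRing.Theory Num.Theory.
Import numFieldNormedType.Exports.

Local Open Scope classical_set_scope.
Local Open Scope ring_scope.

(** * Continuity and Borel measurability *)

Lemma lipschitz_continuous (R : realType) (V W : normedModType R) (k : R) (f : V -> W) :
  (forall x y, `|f x - f y| <= k * `|x - y|) -> continuous f.
Proof.
move=> fk x; apply/cvgrPdist_lt => e e0.
(* The constant [k] may be zero or negative, so [e] is divided by [|k| + 1] instead. *)
have c0 : 0 < `|k| + 1 by rewrite ltr_wpDl.
near=> y; rewrite (le_lt_trans (fk _ _))//.
rewrite (@le_lt_trans _ _ ((`|k| + 1) * `|x - y|))//.
  by rewrite ler_wpM2r// (le_trans (ler_norm _))// lerDl.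
rewrite mulrC -ltr_pdivlMr//; near: y.
apply: cvgr_dist_lt => //; last exact: divr_gt0.
Unshelve. all: by end_near. Qed.

Lemma measurable_continuous_borel (R : realType) (V : normedModType R) (f : V -> R) :
  continuous f -> measurable_fun setT (f : borel V -> R).
Proof.
move=> cf; apply: (measurability _ (RGenOpens.measurableE R)) => _ [_ [a [b ->]] <-].
rewrite setTI; apply: sub_sigma_algebra; apply: open_comp => // x _; exact: cf.
Qed.

(** * The inner product of L2 *)

Section L2_dot_theory.
Context d (T : measurableType d) (R : realType) (mu : {measure set T -> \bar R}).
Local Notation L2 := (LspaceType mu (lee1n 2)).
Implicit Types (u v w : L2) (a : R).

Lemma L2_mul_integrable u v :
  mu.-integrable setT (EFin \o (fun x => (u : T -> R) x * (v : T -> R) x)).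
Proof.
apply/Lfun1_integrable; apply: Lfun2_mul_Lfun1; exact: Lfun_of_subproof.
Qed.

Lemma L2_dotC u v : L2_dot u v = L2_dot v u.
Proof. by apply: eq_Rintegral => x _; rewrite mulrC. Qed.

(** Sums and multiples of classes agree with the pointwise operations only almost everywhere; this
    transfers linearity of the integral to [L2_dot]. *)
Lemma ae_eq_Rintegral_mul (f g h : T -> R) : measurable_fun setT f ->
    measurable_fun setT g -> measurable_fun setT h -> f = g %[ae mu] ->
  (\int[mu]_x (f x * h x) = \int[mu]_x (g x * h x))%R.
Proof.
move=> mf mg mh fg; congr fine; apply: ae_eq_integral => //.
- by apply/measurable_EFinP; exact: measurable_funM.
- by apply/measurable_EFinP; exact: measurable_funM.
- by apply: filterS fg => x /= /(_ I) fgx _; rewrite fgx.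
Qed.

Lemma measurable_L2 u : measurable_fun setT (u : T -> R).
Proof. exact: (measurable_funPT (Lfun_of u)). Qed.

Lemma L2_addE u v :
  ((u + v : L2) : T -> R) = (fun x => (u : T -> R) x + (v : T -> R) x) %[ae mu].
Proof. exact: Lspace_of_ae. Qed.

Lemma L2_scaleE a u :
  ((a *: u : L2) : T -> R) = (fun x => a * (u : T -> R) x) %[ae mu].
Proof. exact: Lspace_of_ae. Qed.

Lemma L2_dotDl u v w : L2_dot (u + v) w = L2_dot u w + L2_dot v w.
Proof.
have mu' := measurable_L2 u; have mv := measurable_L2 v.
rewrite /L2_dot (ae_eq_Rintegral_mul _ _ _ (L2_addE u v)).
- rewrite -RintegralD//; try exact: L2_mul_integrable.
  by apply: eq_Rintegral => x _; rewrite mulrDl.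
- exact: measurable_L2.
- exact: measurable_funD.
- exact: measurable_L2.
Qed.

Lemma L2_dotZl a u w : L2_dot (a *: u) w = a * L2_dot u w.
Proof.
have mu' := measurable_L2 u.
rewrite /L2_dot (ae_eq_Rintegral_mul _ _ _ (L2_scaleE a u)).
- rewrite -RintegralZl//; last exact: L2_mul_integrable.
  by apply: eq_Rintegral => x _; rewrite mulrA.
- exact: measurable_L2.
- exact: measurable_funM.
- exact: measurable_L2.
Qed.

Lemma L2_dotDr u v w : L2_dot u (v + w) = L2_dot u v + L2_dot u w.
Proof. by rewrite L2_dotC L2_dotDl !(L2_dotC u). Qed.

Lemma L2_dotZr a u w : L2_dot u (a *: w) = a * L2_dot u w.
Proof. by rewrite L2_dotC L2_dotZl L2_dotC. Qed.

Lemma L2_dotNl u w : L2_dot (- u) w = - L2_dot u w.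
Proof. by rewrite -scaleN1r L2_dotZl mulN1r. Qed.

Lemma L2_dotBl u v w : L2_dot (u - v) w = L2_dot u w - L2_dot v w.
Proof. by rewrite L2_dotDl L2_dotNl. Qed.

Lemma L2_dotBr u v w : L2_dot u (v - w) = L2_dot u v - L2_dot u w.
Proof. by rewrite L2_dotC L2_dotBl !(L2_dotC u). Qed.

Lemma L2_dot0l w : L2_dot 0 w = 0.
Proof. by rewrite -(scale0r 0) L2_dotZl mul0r. Qed.

Lemma L2_dot_suml (I : Type) (r : seq I) (Q : pred I) (F : I -> L2) w :
  L2_dot (\sum_(i <- r | Q i) F i) w = \sum_(i <- r | Q i) L2_dot (F i) w.
Proof.
by apply: (big_morph (fun u => L2_dot u w)) => [u v|]; rewrite ?L2_dotDl ?L2_dot0l.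
Qed.

Lemma L2_dot_sumr (I : Type) (r : seq I) (Q : pred I) (F : I -> L2) w :
  L2_dot w (\sum_(i <- r | Q i) F i) = \sum_(i <- r | Q i) L2_dot w (F i).
Proof. by rewrite L2_dotC L2_dot_suml; apply: eq_bigr => i _; rewrite L2_dotC. Qed.

Lemma L2_dot_norm u : L2_dot u u = `|u| ^+ 2.
Proof.
rewrite L2_normE unlock /L2_dot /Rintegral.
set s := (\int[mu]_x _)%E; set t := (\int[mu]_x _)%E.
have -> : t = s.
  apply: eq_integral => x _ /=.
  by rewrite -expr2 powR_mulrn// real_normK ?num_real//.
have s0 : (0 <= s)%E by apply: integral_ge0 => x _; rewrite lee_fin -expr2 sqr_ge0.
have : s \is a fin_num by apply: integrable_fin_num => //; exact: L2_mul_integrable.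
move: s s0 => [r| |]// r0 _.
by rewrite poweR_EFin /= -powR_mulrn ?powR_ge0// -powRrM mulVf// powRr1.
Qed.

Lemma L2_dot_ge0 u : 0 <= L2_dot u u.
Proof. by rewrite L2_dot_norm sqr_ge0. Qed.

(** With [v] the projection of [u] onto the span of the [g i], both [<u, v>] and [<v, v>] equal the
    sum, so the claim is [0 <= <u - v, u - v>]. *)
Lemma L2_bessel n (g : 'I_n -> L2) :
  (forall i j, L2_dot (g i) (g j) = (i == j)%:R) ->
  forall u, \sum_i L2_dot u (g i) ^+ 2 <= `|u| ^+ 2.
Proof.
move=> og u; pose v : L2 := \sum_i L2_dot u (g i) *: g i.
have uv : L2_dot u v = \sum_i L2_dot u (g i) ^+ 2.
  by rewrite L2_dot_sumr; apply: eq_bigr => i _; rewrite L2_dotZr.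
have vv : L2_dot v v = \sum_i L2_dot u (g i) ^+ 2.
  rewrite L2_dot_suml; apply: eq_bigr => i _; rewrite L2_dotZl L2_dot_sumr.
  rewrite (bigD1 i)//= L2_dotZr og eqxx mulr1 big1 ?addr0// => j ji.
  by rewrite L2_dotZr og eq_sym (negbTE ji) mulr0.
have := L2_dot_ge0 (u - v).
rewrite L2_dotBl !L2_dotBr (L2_dotC v u) uv vv subrr subr0 subr_ge0.
by rewrite L2_dot_norm.
Qed.

Lemma L2_dot_unit_le u g : L2_dot g g = 1 -> `|L2_dot u g| <= `|u|.
Proof.
move=> g1; have og (i j : 'I_1) : L2_dot g g = (i == j)%:R by rewrite !ord1.
have := @L2_bessel 1 (fun=> g) og u; rewrite big_ord1 => gu.
by rewrite -ler_sqr ?nnegrE// real_normK ?num_real.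
Qed.

Lemma L2_cauchy_schwarz u g : `|L2_dot u g| <= `|u| * `|g|.
Proof.
have [->|g0] := eqVneq g 0.
  by rewrite L2_dotC L2_dot0l !normr0 mulr0.
have ng : `|g| != 0 by rewrite normr_eq0.
rewrite -ler_pdivrMr ?normr_gt0//.
(* Normalizing [g] reduces the claim to the one-vector case of Bessel. *)
have := @L2_dot_unit_le u (`|g|^-1 *: g).
rewrite L2_dotZr L2_dotZl L2_dotZr L2_dot_norm expr2 mulKf// mulVf// => /(_ erefl).
by rewrite normrM normfV normr_id mulrC.
Qed.

Lemma measurable_L2_dot w g :
  measurable_fun setT ((fun u : L2 => L2_dot (u - w) g) : borel L2 -> R).
Proof.
apply: measurable_continuous_borel; apply: (@lipschitz_continuous _ _ _ `|g|) => u v.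
by rewrite -L2_dotBl opprB addrA subrK mulrC L2_cauchy_schwarz.
Qed.

End L2_dot_theory.

(** * Orthonormal families and Ky Fan's principle *)

(** Compare [c] with the indicator of [p <= k], which has the same total weight. Subtracting the
    threshold [t = lambda p] from [lambda] therefore changes nothing, and then each term
    [(lambda k - t) * (c k - (p <= k))] is nonnegative. *)
Lemma le_sum_weighted (R : realType) (lambda c : nat -> R) (p N : nat) :
    (p <= N)%N -> nonincreasing_seq lambda ->
    (forall k, (k < N)%N -> 0 <= c k <= 1) ->
    \sum_(0 <= k < N) c k = (N - p)%:R ->
  \sum_(p <= k < N) lambda k <= \sum_(0 <= k < N) lambda k * c k.
Proof.
move=> pN dl c01 sc; pose t := lambda p.
have ind a : \sum_(0 <= k < N) a k * (p <= k)%:R = \sum_(p <= k < N) a k :> R.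
  rewrite (big_cat_nat (n := p))//=.
  rewrite [X in X + _](_ : _ = 0) ?add0r; last first.
    by rewrite big_nat big1// => k /andP[_ kp]; rewrite leqNgt kp mulr0.
  by apply: eq_big_nat => k /andP[pk _]; rewrite pk mulr1.
rewrite -ind.
have : \sum_(0 <= k < N) t * (c k - (p <= k)%:R) <=
    \sum_(0 <= k < N) lambda k * (c k - (p <= k)%:R).
  rewrite !big_nat; apply: ler_sum => k /andP[_ kN].
  have /andP[c0 c1] := c01 k kN; case: leqP => pk.
    by rewrite ler_wnM2r ?subr_le0// dl.
  by rewrite subr0 ler_wpM2r// dl// ltnW.
rewrite -mulr_sumr sumrB sc.
have -> : \sum_(0 <= k < N) (p <= k)%:R = (N - p)%:R :> R.
  under eq_bigr do rewrite -[_%:R]mul1r.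
  by rewrite (ind (fun=> 1)) sumr_const_nat.
rewrite subrr mulr0; under eq_bigr do rewrite mulrBr.
by rewrite sumrB subr_ge0.
Qed.

Section orthonormal_families.
Context d (T : measurableType d) (R : realType) (mu : {measure set T -> \bar R}).
Local Notation L2 := (LspaceType mu (lee1n 2)).

(** The matrix of inner products has more rows than columns, so its left kernel contains a nonzero
    row. Its entries are the coefficients of a vector orthogonal to [u], nonzero by independence of
    [b]. *)
Lemma exists_unit_orthogonal n (b : 'I_n -> L2) (u : seq L2) :
    lin_indep b -> (size u < n)%N ->
  exists v, [/\ lin_span b v, L2_dot v v = 1 & {in u, forall w, L2_dot v w = 0}].
Proof.
move=> bfree un.
pose M : 'M[R]_(n, size u) := \matrix_(i, j) L2_dot (b i) u`_j.
have /matrix0Pn[i0 [j0 Mij]] : kermx M != 0.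
  by rewrite -mxrank_eq0 mxrank_ker subn_eq0 -ltnNge (leq_ltn_trans (rank_leq_col M)).
pose c i := kermx M i0 i; pose v := \sum_i c i *: b i.
have vu : {in u, forall w, L2_dot v w = 0}.
  move=> w wu; have jw : (index w u < size u)%N by rewrite index_mem.
  have /matrixP/(_ i0 (Ordinal jw)) := mulmx_ker M.
  rewrite !mxE => <-; rewrite L2_dot_suml; apply: eq_bigr => i _.
  by rewrite L2_dotZl; congr (_ * _); rewrite mxE /= nth_index.
have v0 : v != 0.
  by apply: contra_neq Mij => /bfree; exact.
exists (`|v|^-1 *: v); split.
- exists (fun i => `|v|^-1 * c i); rewrite scaler_sumr; apply: eq_bigr => i _.
  by rewrite scalerA.
- by rewrite L2_dotZl L2_dotZr L2_dot_norm expr2 mulKf ?mulVf ?normr_eq0.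
- by move=> w wu; rewrite L2_dotZl vu ?mulr0.
Qed.

(** Indexing by [nat] with a bound lets a family grow by one vector without changing its index
    type. *)
Definition orthonormal (e : nat -> L2) (k : nat) :=
  forall i j, (i < k)%N -> (j < k)%N -> L2_dot (e i) (e j) = (i == j)%:R.

Lemma orthonormal_extend (e : nat -> L2) k v : orthonormal e k ->
    L2_dot v v = 1 -> (forall i, (i < k)%N -> L2_dot v (e i) = 0) ->
  orthonormal (fun i => if (i < k)%N then e i else v) k.+1.
Proof.
move=> oe vv ve i j; rewrite !ltnS => ik jk.
case: ltnP => [ik'|ki]; case: ltnP => [jk'|kj]; first exact: oe.
- by rewrite L2_dotC ve//; case: eqP ik' => // ->; rewrite ltnNge kj.
- by rewrite ve//; case: eqP jk' => // <-; rewrite ltnNge ki.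
- by rewrite vv (@anti_leq i j) ?eqxx// (leq_trans ik)// (leq_trans jk).
Qed.

Lemma exists_orthonormal n (b : 'I_n -> L2) (u : seq L2) k :
    lin_indep b -> (size u + k <= n)%N ->
  exists g, [/\ orthonormal g k, forall i, (i < k)%N -> lin_span b (g i) &
    forall i, (i < k)%N -> {in u, forall w, L2_dot (g i) w = 0}].
Proof.
move=> bfree; elim: k => [|k IHk] ukn; first by exists (fun=> 0).
rewrite addnS in ukn; have [g [og gb gu]] := IHk (ltnW ukn).
(* The vectors already chosen join the list that the new one must be orthogonal to. *)
have [|v [vb vv vug]] := @exists_unit_orthogonal n b (u ++ mkseq g k) bfree.
  by rewrite size_cat size_mkseq.
exists (fun i => if (i < k)%N then g i else v); split.
- apply: orthonormal_extend => // i ik; apply: vug; rewrite mem_cat.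
  by apply/orP; right; apply/mapP; exists i => //; rewrite mem_iota.
- by move=> i _; case: ifP => // /gb.
- move=> i _; case: ifP => [/gu//|_] w wu.
  by apply: vug; rewrite mem_cat wu.
Qed.

Definition symmetric_op (A : L2 -> L2) := forall v w, L2_dot (A v) w = L2_dot v (A w).

(** Entries of [s] lie below [k], so [k :: s] is still duplicate-free and [P] has more than [size s]
    elements. With [P] the indices of one eigenvalue, fewer than its multiplicity occur before
    [k]. *)
Lemma size_lt_card (P : set nat) (n k : nat) (s : seq nat) :
  (P #= `I_n)%card -> P k -> uniq s -> {in s, forall i, (i < k)%N /\ P i} ->
  (size s < n)%N.
Proof.
move=> Pn Pk us sP; rewrite -card_le_II.
have ut : uniq (k :: s).
  by rewrite /= us andbT; apply/negP => /sP[]; rewrite ltnn.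
have nthI : {in `I_(size s).+1 &, injective (nth 0%N (k :: s))}.
  by move=> i j; rewrite !inE /= => ik jk /eqP; rewrite nth_uniq// => /eqP.
rewrite -(card_le_eql (inj_card_eq nthI)) -(card_le_eqr Pn).
apply: subset_card_le => _ [i /= ik <-].
have := mem_nth 0%N (ik : (i < size (k :: s))%N).
by rewrite inE => /orP[/eqP->//|/sP[]].
Qed.

(** By induction: fewer earlier vectors share the eigenvalue [lambda N] than its eigenspace has
    dimensions, so the eigenspace contains a unit vector orthogonal to them. Symmetry of [A] makes
    it orthogonal to the vectors of the other eigenvalues. *)
Lemma exists_eigenvectors (A : L2 -> L2) (lambda : nat -> R) (N : nat) :
    symmetric_op A -> eigenvalue_sequence A lambda ->
    (forall k, (k < N)%N -> 0 < lambda k) ->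
  exists2 e, orthonormal e N & forall k, (k < N)%N -> A (e k) = lambda k *: e k.
Proof.
move=> sA [_ _ evA]; elim: N => [|N IHN] lambda_gt0; first by exists (fun=> 0).
have [|e oe Ae] := IHN; first by move=> k kN; apply: lambda_gt0; exact: ltnW.
have [n [[b [bfree spanb]] cardn]] := evA _ (lambda_gt0 N (leqnn _)).
pose s := [seq i <- iota 0 N | lambda i == lambda N].
have [|v [vb vv ve]] := @exists_unit_orthogonal n b [seq e i | i <- s] bfree.
  rewrite size_map; apply: (size_lt_card (k := N) cardn) => //.
    by rewrite filter_uniq// iota_uniq.
  by move=> i; rewrite mem_filter mem_iota => /andP[/eqP].
have Av : A v = lambda N *: v by move: vb; rewrite spanb.
exists (fun i => if (i < N)%N then e i else v).
  apply: orthonormal_extend => // i iN.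
  have [liN|liN] := eqVneq (lambda i) (lambda N).
    by apply: ve; rewrite map_f// mem_filter mem_iota liN eqxx.
  have /eqP : L2_dot (A v) (e i) = L2_dot v (A (e i)) by exact: sA.
  rewrite Av Ae// L2_dotZl L2_dotZr eq_sym -subr_eq0 -mulrBl mulf_eq0 subr_eq0.
  by rewrite (negbTE liN) => /eqP.
move=> k; rewrite ltnS; case: ltnP => [kN _|Nk kN]; first exact: Ae.
by rewrite Av (@anti_leq k N)// kN.
Qed.

(* Ky Fan: the weights [\sum_j <g_j, e_k>^2] lie in [0, 1] and add up to [N - p]. *)
Lemma exists_orthonormal_trace_ge (A : L2 -> L2) (lambda : nat -> R) (p N : nat)
    (u : seq L2) :
    symmetric_op A -> eigenvalue_sequence A lambda ->
    (forall k, (k < N)%N -> 0 < lambda k) -> (p <= N)%N -> size u = p ->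
  exists g : nat -> L2, [/\ orthonormal g (N - p),
    forall i, (i < N - p)%N -> {in u, forall w, L2_dot (g i) w = 0} &
    \sum_(p <= k < N) lambda k <= \sum_(j < N - p) L2_dot (A (g j)) (g j)].
Proof.
move=> sA evA lambda_gt0 pN up.
have [e oe Ae] := exists_eigenvectors sA evA lambda_gt0.
have dote (a : 'I_N -> R) (i : 'I_N) : L2_dot (\sum_k a k *: e k) (e i) = a i.
  rewrite L2_dot_suml (bigD1 i)//= L2_dotZl oe// eqxx mulr1 big1 ?addr0// => j ji.
  by rewrite L2_dotZl oe// (negbTE ji : (j == i :> nat) = false) mulr0.
have efree : lin_indep (fun k : 'I_N => e k).
  by move=> a ae i; rewrite -(dote a i) ae L2_dot0l.
(* The [e k] span [N] dimensions and [u] imposes [p] conditions, which leaves room for [N - p]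
   vectors. *)
have [|g [og ge gu]] := @exists_orthonormal _ _ u (N - p) efree.
  by rewrite up subnKC.
exists g; split => //.
pose c k := \sum_(j < N - p) L2_dot (g j) (e k) ^+ 2.
have gE (j : 'I_(N - p)) : g j = \sum_(k < N) L2_dot (g j) (e k) *: e k.
  have [a gj] := ge j (ltn_ord j); rewrite {1}gj; apply: eq_bigr => k _.
  by rewrite gj dote.
(* Only one of the two copies of [g j] is expanded; symmetry then lets [A] act on [e k]. *)
have -> : \sum_(j < N - p) L2_dot (A (g j)) (g j) = \sum_(0 <= k < N) lambda k * c k.
  rewrite big_mkord; under [RHS]eq_bigr do rewrite mulr_sumr.
  rewrite exchange_big/=; apply: eq_bigr => j _.
  rewrite {2}gE L2_dot_sumr; apply: eq_bigr => k _.
  by rewrite L2_dotZr sA Ae// L2_dotZr expr2 mulrCA.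
apply: le_sum_weighted => //; first by case: evA.
(* The bound by 1 is Bessel's inequality for the unit vector [e k] and the family [g]. *)
- move=> k kN; rewrite sumr_ge0/=; last by move=> *; exact: sqr_ge0.
  have := @L2_bessel _ _ _ mu (N - p) (fun j => g j) _ (e k).
  rewrite -L2_dot_norm oe// eqxx; under eq_bigr do rewrite L2_dotC.
  by apply => i j; rewrite og.
(* Summed over [k] first, the squares give [<g j, g j> = 1], as [g j] lies in the span of the
   [e k]. *)
- rewrite big_mkord exchange_big/= (eq_bigr (fun=> 1)) ?sumr_const ?card_ord// => j _.
  transitivity (L2_dot (g j) (g j)); last by rewrite og// eqxx.
  rewrite [in RHS]gE L2_dot_suml; apply: eq_bigr => k _.
  by rewrite L2_dotZl -gE (L2_dotC (e k)) expr2.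
Qed.

(** Duality makes the residual orthogonal to every [taus k]. The coefficient matrix of [taus] in
    [tau] is a left inverse of the Gram matrix, hence also a right inverse, so each [tau l] is a
    combination of the [taus k]. *)
Lemma dual_basis_projection_orthogonal p (tau taus : 'I_p -> L2) :
    (forall k, lin_span tau (taus k)) ->
    (forall l k, L2_dot (tau l) (taus k) = (l == k)%:R) ->
  forall x l, L2_dot (x - \sum_k L2_dot x (taus k) *: tau k) (tau l) = 0.
Proof.
move=> /choice[c cE] dual x l.
pose C : 'M[R]_p := \matrix_(k, j) c k j.
pose Gm : 'M[R]_p := \matrix_(j, i) L2_dot (tau j) (tau i).
have CG : C *m Gm = 1%:M.
  apply/matrixP => k i; rewrite !mxE eq_sym -dual L2_dotC cE L2_dot_suml.
  by apply: eq_bigr => j _; rewrite !mxE L2_dotZl.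
have /matrixP GC := mulmx1C CG.
have -> : tau l = \sum_k Gm l k *: taus k.
  transitivity (\sum_j (1%:M : 'M[R]_p) l j *: tau j).
    rewrite (bigD1 l)//= mxE eqxx scale1r big1 ?addr0// => j jl.
    by rewrite mxE eq_sym (negbTE jl) scale0r.
  under [RHS]eq_bigr do rewrite cE scaler_sumr.
  rewrite exchange_big/=; apply: eq_bigr => j _.
  rewrite -GC mxE scaler_suml; apply: eq_bigr => k _.
  by rewrite mxE scalerA mxE.
rewrite L2_dot_sumr big1// => k _.
rewrite L2_dotZr L2_dotBl L2_dot_suml (bigD1 k)//= L2_dotZl dual eqxx mulr1.
rewrite big1 ?addr0 ?subrr ?mulr0// => j jk.
by rewrite L2_dotZl dual (negbTE jk) mulr0.
Qed.

End orthonormal_families.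

(* The integral of a nonnegative function is the supremum of the integrals of the
   simple functions below it, so measurability is not needed. *)
Lemma ge0_le_integralT d (T : measurableType d) (R : realType)
    (mu : {measure set T -> \bar R}) (f g : T -> \bar R) :
    (forall x, 0 <= f x)%E -> (forall x, f x <= g x)%E ->
  (\int[mu]_x f x <= \int[mu]_x g x)%E.
Proof.
move=> f0 fg; have g0 x : (0 <= g x)%E := le_trans (f0 x) (fg x).
rewrite !ge0_integralTE//; apply: le_ereal_sup => _ [h hf <-].
by exists h => // x; exact: le_trans (hf x) (fg x).
Qed.

Lemma EFin_Rintegral d (T : measurableType d) (R : realType)
    (mu : {measure set T -> \bar R}) (f : T -> R) :
    mu.-integrable setT (EFin \o f) ->
  (\int[mu]_x (f x)%:E)%E = (\int[mu]_x f x)%R%:E.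
Proof. by move=> intf; rewrite fineK//; exact: integrable_fin_num. Qed.

(** * Bochner integrals paired with a fixed vector *)

Section bochner_dot.
Context d0 (Y : measurableType d0) (R : realType) (mu : {measure set Y -> \bar R}).
Local Notation L2 := (LspaceType mu (lee1n 2)).
Context d (T : measurableType d) (nu : {finite_measure set T -> \bar R}).
Implicit Types (f s : T -> L2) (g : L2).

(** Writing the pairing as a finite combination of indicators allows it to be integrated term by
    term. *)
Lemma simple_function_dotE s g x : simple_function s ->
  L2_dot (s x) g =
    \sum_(v <- fset_set (range s)) L2_dot v g * \1_(s @^-1` [set v]) x.
Proof.
move=> [fs _].
rewrite (bigD1_seq (s x)) ?fset_uniq//=; last first.
  by rewrite in_fset_set// inE; exists x.
rewrite indicE mem_set// mulr1 big1 ?addr0// => v vs.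
by rewrite indicE memNset ?mulr0//= => /esym/eqP; rewrite (negbTE vs).
Qed.

Lemma simple_function_dot s g : simple_function s ->
  nu.-integrable setT (EFin \o (fun x => L2_dot (s x) g)) /\
  (\int[nu]_x L2_dot (s x) g)%R = L2_dot (simple_integral nu s) g.
Proof.
move=> ss; have [fs ms] := ss.
have intv v : nu.-integrable setT
    (fun x => (L2_dot v g * \1_(s @^-1` [set v]) x)%:E).
  under eq_fun do rewrite EFinM.
  by apply: integrableZl => //; exact: integrable_indic.
split.
  rewrite (_ : _ \o _ = (fun x => \sum_(v <- fset_set (range s))
      (L2_dot v g * \1_(s @^-1` [set v]) x)%:E)%E).
    by apply: integrable_sum => // v _; exact: intv.
  by apply/funext => x; rewrite /= sumEFin -simple_function_dotE.
under eq_Rintegral do rewrite (simple_function_dotE g _ ss).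
rewrite /Rintegral; under eq_integral do rewrite -sumEFin.
rewrite integral_sum// /simple_integral fsbig_finite//= L2_dot_suml.
rewrite (eq_bigr (fun v => (L2_dot v g * fine (nu (s @^-1` [set v])))%:E)).
  rewrite sumEFin /=; by apply: eq_bigr => v _; rewrite L2_dotZl mulrC.
move=> v _; under eq_integral do rewrite EFinM.
rewrite integralZl//; last exact: integrable_indic.
rewrite integral_indic// setIT EFinM; congr (_ * _)%E.
by rewrite fineK//; exact: fin_num_measure.
Qed.

(** For a unit vector [g], pairing does not increase the norm, so the L1 convergence of the simple
    functions passes to the scalar functions. *)
Lemma bochner_dot_unit f I g : L2_dot g g = 1 -> is_bochner_integral nu f I ->
  nu.-integrable setT (EFin \o (fun x => L2_dot (f x) g)) /\
  (\int[nu]_x L2_dot (f x) g)%R = L2_dot I g.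
Proof.
move=> g1 [mf [s [ss fs sI]]].
have sint k := (simple_function_dot g (ss k)).1.
have mfg : measurable_fun setT (fun x => L2_dot (f x) g).
  have := measurable_L2_dot 0 g; under eq_fun do rewrite subr0.
  by move=> mg; exact: (measurableT_comp mg mf).
have msg k : measurable_fun setT (fun x => L2_dot (s k x) g).
  by have /measurable_int/measurable_EFinP := sint k.
have fsg k : (\int[nu]_x `|L2_dot (f x) g - L2_dot (s k x) g|%:E <=
    \int[nu]_x `|f x - s k x|%:E)%E.
  apply: ge0_le_integralT => x; rewrite lee_fin// -L2_dotBl.
  exact: L2_dot_unit_le.
have /fine_cvgP[fin_fs cvg_fs] := fs.
have near_fs e : 0 < e -> \forall k \near \oo,
    (\int[nu]_x `|L2_dot (f x) g - L2_dot (s k x) g|%:E < e%:E)%E.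
  move=> e0; near=> k; apply: (le_lt_trans (fsg k)).
  rewrite -[ltLHS]fineK; last by near: k.
  rewrite lte_fin (le_lt_trans (ler_norm _))// -normrN -sub0r.
  by near: k; move/cvgrPdist_lt : cvg_fs => /(_ _ e0).
have dint k : (\int[nu]_x `|L2_dot (f x) g - L2_dot (s k x) g|%:E < +oo)%E ->
    nu.-integrable setT (EFin \o (fun x => L2_dot (f x) g - L2_dot (s k x) g)).
  move=> fsy; apply/integrableP; split => //.
  by apply/measurable_EFinP; exact: measurable_funB.
(* A single [s k] at finite L1 distance suffices: add its integrable pairing to the integrable
   difference. *)
have fint : nu.-integrable setT (EFin \o (fun x => L2_dot (f x) g)).
  have [k _ /(_ k (leqnn _)) /= fsk] := near_fs 1 ltr01.
  have dk := dint k (lt_trans fsk (ltry _)).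
  have := integrableD measurableT dk (sint k).
  by apply: eq_integrable => // x _ /=; rewrite -EFinD subrK.
split => //; apply/eqP; rewrite -subr_eq0 -normr_le0; apply/ler_addgt0Pl => e e0.
rewrite addr0; have e2 : 0 < e / 2 by rewrite divr_gt0.
near \oo => k.
have fsk : (\int[nu]_x `|L2_dot (f x) g - L2_dot (s k x) g|%:E < (e / 2)%:E)%E.
  by near: k; exact: near_fs.
have Ik : `|I - simple_integral nu (s k)| < e / 2.
  by near: k; move/cvgrPdist_lt : sI => /(_ _ e2).
(* Half of [e] bounds the distance of the scalar integrals of [f] and [s k], the other half that of
   [simple_integral nu (s k)] and [I]. *)
rewrite -(subrK (L2_dot (simple_integral nu (s k)) g) (\int[nu]_x _)%R) -addrA.
rewrite (le_trans (ler_normD _ _))// (splitr e) lerD//; last first.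
  by rewrite -L2_dotBl (le_trans (L2_dot_unit_le _ g1))// distrC ltW.
rewrite -(simple_function_dot g (ss k)).2 -RintegralB//.
have dk := dint k (lt_trans fsk (ltry _)).
rewrite (le_trans (le_normr_Rintegral measurableT dk))//.
rewrite -lee_fin -EFin_Rintegral ?ltW//; exact: integrable_norm.
Unshelve. all: by end_near. Qed.

Lemma bochner_dot f I g : is_bochner_integral nu f I ->
  nu.-integrable setT (EFin \o (fun x => L2_dot (f x) g)) /\
  (\int[nu]_x L2_dot (f x) g)%R = L2_dot I g.
Proof.
move=> fI; have [->|g0] := eqVneq g 0.
  rewrite (_ : (fun x => _) = cst 0); last first.
    by apply/funext => x; rewrite L2_dotC L2_dot0l.
  rewrite L2_dotC L2_dot0l; split; first exact: integrable0.
  by rewrite Rintegral_cst// mul0r.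
have ng : `|g| != 0 by rewrite normr_eq0.
pose h := `|g|^-1 *: g.
have hh : L2_dot h h = 1.
  by rewrite L2_dotZl L2_dotZr L2_dot_norm expr2 mulKf// mulVf.
have gE v : L2_dot v g = `|g| * L2_dot v h by rewrite L2_dotZr mulVKf.
have [hint hE] := bochner_dot_unit hh fI.
rewrite (_ : (fun x => _) = (fun x => `|g| * L2_dot (f x) h)); last first.
  by apply/funext => x.
split; last by rewrite RintegralZl// hE -gE.
by have := integrableZl measurableT `|g| hint.
Qed.

End bochner_dot.

(** * Mean and covariance in weak form *)

Section covariance_operator.
Context d (T : measurableType d) (R : realType) (mu : {measure set T -> \bar R}).
Local Notation L2 := (LspaceType mu (lee1n 2)).
Variable (nu : probability (borel L2) R).
Implicit Types (v w g : L2) (C : L2 -> L2).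

(** Pairing the Bochner integrals of the mean and of the covariance with [g] leaves only scalar
    integrals for the later arguments. *)
Lemma is_covariance_operatorP C : is_covariance_operator nu C ->
  exists m : L2, forall w g,
  [/\ nu.-integrable setT (EFin \o (fun v : L2 => L2_dot (v - m) g)),
      (\int[nu]_v L2_dot ((v : L2) - m) g)%R = 0,
      nu.-integrable setT
        (EFin \o (fun v : L2 => L2_dot (v - m) w * L2_dot (v - m) g)) &
      (\int[nu]_v (L2_dot ((v : L2) - m) w * L2_dot ((v : L2) - m) g))%R =
        L2_dot (C w) g].
Proof.
move=> [m meanm covC]; exists m => w g.
have [mint mE] := bochner_dot g meanm.
have [cint cE] := bochner_dot g (covC w).
have mgint : nu.-integrable setT (EFin \o (fun _ : L2 => L2_dot m g)).
  exact: finite_measure_integrable_cst.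
split.
- have := integrableB measurableT mint mgint.
  by apply: eq_integrable => // v _ /=; rewrite L2_dotBl EFinB.
- under eq_Rintegral do rewrite L2_dotBl.
  rewrite RintegralB// mE Rintegral_cst// [X in fine X](_ : _ = 1%E) ?mulr1 ?subrr//.
  exact: probability_setT.
- by move: cint; apply: eq_integrable => // v _ /=; rewrite L2_dotZl.
- by rewrite -cE; apply: eq_Rintegral => v _; rewrite L2_dotZl.
Qed.

Lemma covariance_symmetric C : is_covariance_operator nu C -> symmetric_op C.
Proof.
move=> /is_covariance_operatorP[m mC] v w; rewrite [RHS]L2_dotC.
have [_ _ _ <-] := mC v w; have [_ _ _ <-] := mC w v.
by apply: eq_Rintegral => x _; rewrite mulrC.
Qed.

(** With [X = <v - m, g>] and [c = <m - t, g>], the second moment about [t] is that of [X + c]. The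
    cross term vanishes as [X] has mean zero, so it exceeds the variance by [c ^+ 2]. *)
Lemma covariance_le_moment2 C (t g : L2) : is_covariance_operator nu C ->
  ((L2_dot (C g) g)%:E <= \int[nu]_v (L2_dot ((v : L2) - t) g ^+ 2)%:E)%E.
Proof.
move=> /is_covariance_operatorP[m /(_ g g)[int1 E1 int2 E2]].
set X := (fun v : L2 => L2_dot (v - m) g) in int1 E1 int2 E2 *.
pose c := L2_dot (m - t) g.
have cint : nu.-integrable setT (EFin \o (fun _ : L2 => c ^+ 2)).
  exact: finite_measure_integrable_cst.
have int3 : nu.-integrable setT (EFin \o (fun v => (c *+ 2) * X v)).
  by have := integrableZl measurableT (c *+ 2) int1.
have int4 : nu.-integrable setT (EFin \o (fun v => X v * X v + (c *+ 2) * X v)).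
  by have := integrableD measurableT int2 int3.
have int5 : nu.-integrable setT
    (EFin \o (fun v => X v * X v + (c *+ 2) * X v + c ^+ 2)).
  by have := integrableD measurableT int4 cint.
rewrite (_ : (\int[nu]_v _)%E =
    (\int[nu]_v (X v * X v + (c *+ 2) * X v + c ^+ 2)%:E)%E).
  rewrite EFin_Rintegral// lee_fin RintegralD// RintegralD// E2 RintegralZl// E1.
  rewrite mulr0 addr0 Rintegral_cst// lerDl mulr_ge0 ?sqr_ge0// fine_ge0//.
apply: eq_integral => v _; congr EFin.
have -> : L2_dot ((v : L2) - t) g = X v + c.
  by rewrite /X /c -L2_dotDl addrA subrK.
by rewrite sqrrD expr2 mulrnAl (mulrC c).
Qed.

End covariance_operator.

(** * The residual of the optimal affine projection *)

Section affine_projection.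
Context d (T : measurableType d) (R : realType) (mu : {measure set T -> \bar R}).
Local Notation L2 := (LspaceType mu (lee1n 2)).
Variables (p : nat) (tau taus : 'I_p -> L2).
Hypothesis taus_span : forall k, lin_span tau (taus k).
Hypothesis taus_dual : forall l k, L2_dot (tau l) (taus k) = (l == k)%:R.

(** At [x = v - tau_0] this is [v - R(P(v))]; subtracting the offset makes the projection linear. *)
Definition proj_residual (x : L2) : L2 := x - \sum_k L2_dot x (taus k) *: tau k.

Lemma proj_residual_orthogonal x (a : 'I_p -> R) :
  L2_dot (proj_residual x) (\sum_k a k *: tau k) = 0.
Proof.
rewrite L2_dot_sumr big1// => k _.
by rewrite L2_dotZr dual_basis_projection_orthogonal ?mulr0.
Qed.

(** Pythagoras: any competitor differs from the residual by an element of the span of [tau], which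
    is orthogonal to it. *)
Lemma proj_residual_min x (a : 'I_p -> R) :
  `|proj_residual x| <= `|x - \sum_k a k *: tau k|.
Proof.
pose b k := L2_dot x (taus k) - a k.
have -> : x - \sum_k a k *: tau k = proj_residual x + \sum_k b k *: tau k.
  rewrite [X in _ = _ + X](_ : _ =
      \sum_k L2_dot x (taus k) *: tau k - \sum_k a k *: tau k).
    by rewrite /proj_residual addrA subrK.
  by rewrite -sumrB; apply: eq_bigr => k _; rewrite scalerBl.
have := proj_residual_orthogonal x b.
move: (proj_residual x) (\sum_k b k *: tau k) => r y ry.
rewrite -ler_sqr ?nnegrE// -!L2_dot_norm L2_dotDl !L2_dotDr.
rewrite (L2_dotC y r) ry addr0 add0r lerDl.
exact: L2_dot_ge0.
Qed.

(** As [g] is orthogonal to [tau], removing the projection does not change the coefficients of [x]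
    along [g]. *)
Lemma proj_residual_bessel x n (g : 'I_n -> L2) :
    (forall i j, L2_dot (g i) (g j) = (i == j)%:R) ->
    (forall i k, L2_dot (g i) (tau k) = 0) ->
  \sum_i L2_dot x (g i) ^+ 2 <= `|proj_residual x| ^+ 2.
Proof.
move=> og gtau; apply: le_trans (L2_bessel og _).
rewrite le_eqVlt; apply/orP; left; apply/eqP; apply: eq_bigr => i _.
rewrite L2_dotBl L2_dot_suml [X in _ - X]big1 ?subr0// => k _.
by rewrite L2_dotZl (L2_dotC (tau k)) gtau mulr0.
Qed.

(** Orthogonality turns the squared norm into [|x| ^+ 2] minus a finite sum of products of inner
    products, all Borel in [v]. *)
Lemma measurable_proj_residual (t : L2) :
  measurable_fun setT ((fun v : L2 => `|proj_residual (v - t)| ^+ 2) : borel L2 -> R).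
Proof.
have rE x : `|proj_residual x| ^+ 2 =
    `|x| ^+ 2 - \sum_k L2_dot x (taus k) * L2_dot x (tau k).
  rewrite -!L2_dot_norm {2}/proj_residual L2_dotBr proj_residual_orthogonal subr0.
  rewrite L2_dotBl L2_dot_suml; congr (_ - _); apply: eq_bigr => k _.
  by rewrite L2_dotZl (L2_dotC (tau k)).
under eq_fun do rewrite rE.
apply: measurable_funB.
  apply: measurable_funX; apply: measurable_continuous_borel.
  apply: (@lipschitz_continuous _ _ _ 1) => u v.
  by rewrite mul1r (le_trans (ler_dist_dist _ _))// opprB addrA subrK.
by apply: measurable_sum => k; apply: measurable_funM; exact: measurable_L2_dot.
Qed.

End affine_projection.

(** * The two error bounds *)

Lemma eigenvalue_tail_le_residual d (T : measurableType d) (R : realType)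
    (mu : {measure set T -> \bar R}) (L2 := LspaceType mu (lee1n 2))
    (nu : probability (borel L2) R) (C : L2 -> L2) (lambda : nat -> R)
    (p : nat) (tau taus : 'I_p -> L2) (t : L2) :
    (forall k, lin_span tau (taus k)) ->
    (forall l k, L2_dot (tau l) (taus k) = (l == k)%:R) ->
    is_covariance_operator nu C -> eigenvalue_sequence C lambda ->
  (\sum_(p <= k <oo) (lambda k)%:E <=
    \int[nu]_v (`|proj_residual tau taus ((v : L2) - t)| ^+ 2)%:E)%E.
Proof.
move=> tausS tausD covC evC; have [dl l0 _] := evC.
apply: lime_le; first by apply: is_cvg_nneseries => k _ _; rewrite lee_fin.
apply: nearW => N; elim: N => [|N IHN].
  by rewrite big_geq//; apply: integral_ge0 => v _; rewrite lee_fin sqr_ge0.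
have [Np|pN] := ltnP N p.
  by rewrite big_geq//; apply: integral_ge0 => v _; rewrite lee_fin sqr_ge0.
(* A zero eigenvalue adds nothing to the partial sum. Otherwise monotonicity makes all eigenvalues
   up to index [N] positive, and Ky Fan applies to the first [N.+1] of them. *)
have := l0 N; rewrite le_eqVlt => /predU1P[lN0|lN0].
  by rewrite big_nat_recr//= -lN0 adde0.
have lambda_gt0 k : (k < N.+1)%N -> 0 < lambda k.
  by rewrite ltnS => kN; exact: lt_le_trans (dl _ _ kN).
have [g [og gtau trg]] := exists_orthonormal_trace_ge (u := codom tau)
  (covariance_symmetric covC) evC lambda_gt0 (leqW pN)
  (etrans (size_codom tau) (card_ord p)).
rewrite sumEFin; apply: (@le_trans _ _ (\sum_(j < N.+1 - p) L2_dot (C (g j)) (g j))%:E).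
  by rewrite lee_fin.
(* Each term of the trace is at most the second moment about [t]; Bessel for the residual then
   bounds the sum of squares pointwise. *)
apply: (@le_trans _ _
  (\int[nu]_v (\sum_(j < N.+1 - p) (L2_dot ((v : L2) - t) (g j) ^+ 2)%:E))%E).
  rewrite ge0_integral_sum//.
  - by rewrite -sumEFin; apply: lee_sum => j _; exact: covariance_le_moment2.
  - move=> j; apply/measurable_EFinP; apply: measurable_funX.
    exact: measurable_L2_dot.
  - by move=> j v _; rewrite lee_fin sqr_ge0.
apply: ge0_le_integralT => v.
  by apply: sume_ge0 => j _; rewrite lee_fin sqr_ge0.
rewrite sumEFin lee_fin; apply: (@proj_residual_bessel _ _ _ _ _ _ _ _ _ (fun j => g j)).
- by move=> i j; rewrite og.
- by move=> i k; apply: gtau => //; exact: codom_f.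
Qed.

Theorem theorem3p6 (R : realType) (d n : nat)
    (D : compact_domain R d) (U : compact_domain R n)
    (X : completeNormedModType R)
    (X_separable : exists2 S : set X, countable S & dense S)
    (iota : {linear X -> L2 D})
    (iota_inj : injective iota) (iota_continuous : continuous iota)
    (mu : probability (borel X) R)
    (mu_moment2 : (\int[mu]_u (`|u : X| ^+ 2)%:E < +oo)%E)
    (A : set (borel X)) (A_borel : measurable A) (A_full : mu A = 1%E)
    (A_continuous : forall u, A u -> continuous_versions (iota u) !=set0)
    (G : {mfun borel X >-> borel (L2 U)})
    (G_moment2 : (\int[mu]_u (`|G u : L2 U| ^+ 2)%:E < +oo)%E)
    (m p : nat) (N : deeponet D U m p)
    (P : L2 U -> 'rV[R]_p) (P_optimal : is_optimal_projection N P)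
    (Gamma : L2 U -> L2 U)
    (Gamma_covariance : is_covariance_operator (distribution mu G) Gamma)
    (lambda : nat -> R) (lambda_eigenvalues : eigenvalue_sequence Gamma lambda) :
  (sqrte (\sum_(p <= k <oo) (lambda k)%:E)
     <= reconstruction_error N (distribution mu G) P)%E /\
  (reconstruction_error N (distribution mu G) P <= deeponet_error N mu iota G)%E.
Proof.
have [taus [tausS tausD] PE] := P_optimal.
have rE v : `|reconstructor N (P v) - v| =
    `|proj_residual (trunk_basis N) taus (v - trunk0 N)|.
  rewrite -normrN opprB /reconstructor opprD addrA PE.
  by congr (`|_ - _|); apply: eq_bigr => k _; rewrite mxE.
rewrite /reconstruction_error /deeponet_error; under eq_integral do rewrite rE.
rewrite !lee_sqrt; try by apply: integral_ge0 => *; rewrite lee_fin sqr_ge0.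
split.
  exact: (eigenvalue_tail_le_residual (trunk0 N) tausS tausD Gamma_covariance).
(* Changing variables moves the reconstruction error to [X], where the network output is one
   competitor in the minimality of the residual at [G u]. *)
rewrite ge0_integral_distribution//.
- apply: ge0_le_integralT => u; first by rewrite lee_fin sqr_ge0.
  rewrite lee_fin ler_sqr ?nnegrE// /deeponet_eval /reconstructor opprD addrA.
  exact: proj_residual_min.
- by apply/measurable_EFinP; exact: measurable_proj_residual.
Qed.
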